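(* Suppose that a continuous linear operator $T\colon H(\mathbb{D})\to H(\mathbb{D})$ satisfies the following three conditions: (a) $T$ is not injective, (b) $\operatorname{Ker}(T)\subseteq T(H(\mathbb{D}))$, and (c) $\operatorname{Ker}(T)$ is finite dimensional. Let $X:=\operatorname{Ker}(T)$ be equipped with any norm $\|\cdot\|_X$. Then $X$ is a Banach space of analytic functions on $\mathbb{D}$ satisfying $T(X)\subseteq X$. Moreover, its optimal domain $[T,X]=T^{-1}(X)$ satisfies: (i) $X\subsetneqq[T,X]$, (ii) $[T,X]$ is a semi-normed space but $\|\cdot\|_{[T,X]}$ is not a norm, (iii) $X$ is not dense in $[T,X]$, and (iv) $[T,X]$ is a complete semi-normed space.
   Context: $\mathbb{D}=\{z\in\mathbb{C}:|z|<1\}$; $H(\mathbb{D})$ is the Fréchet space of all analytic functions on $\mathbb{D}$ with the topology of uniform convergence on compact sets. A Banach space of analytic functions on $\mathbb{D}$ is a linear subspace $X\subseteq H(\mathbb{D})$ that is a Banach space for some norm $\|\cdot\|_X$ such that the inclusion $X\subseteq H(\mathbb{D})$ is continuous. For such $X$ and a continuous linear $T\colon H(\mathbb{D})\to H(\mathbb{D})$ with $T(X)\subseteq X$, the optimal domain is $[T,X]:=\{f\in H(\mathbb{D}):Tf\in X\}$ with the semi-norm $\|f\|_{[T,X]}:=\|Tf\|_X$; density and completeness refer to this semi-norm (complete means that every Cauchy sequence converges to some, not necessarily unique, element). *)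

(* Defs.v *)
From HB Require Import structures.
From mathcomp Require Import all_boot all_order all_algebra.
From mathcomp Require Import all_classical all_reals all_analysis.
From mathcomp.real_closed Require Import complex.

Set Implicit Arguments.
Unset Strict Implicit.
Unset Printing Implicit Defensive.

Import Order.TTheory GRing.Theory Num.Theory.
Import numFieldNormedType.Exports.

Local Open Scope classical_set_scope.
Local Open Scope ring_scope.

(* Packing [R[i]] as a [numClosedFieldType] gives access to the topology and
   the normed-module structure that MathComp-Analysis attaches to every such
   field. *)
Definition Cplx (R : realType) : numClosedFieldType := R[i].

Definition unit_disc (R : realType) : set (Cplx R) := [set z | `|z| < 1].

(* Compactness is intrinsic, so the compact subsets of the disc are the compact
   subsets of the plane that are contained in it. *)
Definition disc_compacts (R : realType) : set (set (Cplx R)) :=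
  [set K | compact K /\ K `<=` @unit_disc R].

(* Scalars are complex, so [derivable f z 1] is complex differentiability: the
   increment [h] in [h^-1 *: (f (h *: 1 + z) - f z)] tends to 0 in the plane.
   A function on the disc is represented by its extension by 0, which makes the
   representation unique; the disc being open, differentiability at its points
   does not depend on the extension. *)
Definition analytic_on_disc (R : realType) (f : Cplx R -> Cplx R) : Prop :=
  (forall z, @unit_disc R z -> derivable f z 1) /\
  (forall z, ~ @unit_disc R z -> f z = 0).

Definition analyticp (R : realType) : {pred Cplx R -> Cplx R} :=
  [pred f | `[< analytic_on_disc f >]].

Record HD (R : realType) := MkHD {
  HDval :> Cplx R -> Cplx R;
  HDvalP : HDval \in @analyticp R }.

HB.instance Definition _ (R : realType) := [isSub for @HDval R].
HB.instance Definition _ (R : realType) := [Choice of HD R by <:].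

Lemma analyticp_submod (R : realType) : GRing.submod_closed (@analyticp R).
Proof.
split=> [|a f g /asboolP [df f0] /asboolP [dg g0]]; apply/asboolP; split.
- by move=> z _; exact: derivable_cst.
- by [].
- move=> z Dz; apply: derivableD; last exact: dg.
  by apply: derivableZ; exact: df.
- move=> z nDz.
  by rewrite [LHS]/(a * f z + g z) f0 // g0 // mulr0; exact: (addr0 (0 : Cplx R)).
Qed.

HB.instance Definition _ (R : realType) :=
  GRing.isSubmodClosed.Build (Cplx R) (Cplx R -> Cplx R)
    (@analyticp R) (@analyticp_submod R).
HB.instance Definition _ (R : realType) :=
  [SubChoice_isSubLmodule of HD R by <:].

Definition HD_family (R : realType) (f : HD R) :
  {family @disc_compacts R, Cplx R -> Cplx R} := HDval f.

HB.instance Definition _ (R : realType) :=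
  Topological.copy (HD R) (initial_topology (@HD_family R)).

Section SemiNormedSubspaces.
Variables (R : realType) (E : lmodType (Cplx R)).
Implicit Types (V A : set E) (p : E -> R) (u : nat -> E).

Definition linear_subspace V : Prop := GRing.submod_closed [in V].

Definition finite_dimensional V : Prop :=
  exists n (e : 'I_n -> E), (forall i, V (e i)) /\
    forall f, V f -> exists c : 'I_n -> Cplx R, f = \sum_(i < n) c i *: e i.

(* (Semi-)norms on a subspace [V] are total functions on [E] of which only the
   values on [V] matter. The norm of a complex number is itself complex, hence
   the real part. *)
Definition seminorm_on V p : Prop :=
  [/\ forall f, V f -> 0 <= p f,
      forall f g, V f -> V g -> p (f + g) <= p f + p g
    & forall (a : Cplx R) f, V f -> p (a *: f) = complex.Re `|a| * p f].

Definition norm_on V p : Prop :=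
  seminorm_on V p /\ forall f, V f -> p f = 0 -> f = 0.

Definition seminorm_dense A V p : Prop :=
  forall f, V f -> forall e : R, 0 < e -> exists2 g, A g & p (f - g) < e.

Definition seminorm_cauchy u p : Prop :=
  forall e : R, 0 < e -> exists N : nat, forall m n : nat,
    (N <= m)%N -> (N <= n)%N -> p (u m - u n) < e.

Definition seminorm_cvg u p (f : E) : Prop :=
  (fun n => p (u n - f)) @ \oo --> (0 : R).

Definition seminorm_complete V p : Prop :=
  forall u, (forall n, V (u n)) -> seminorm_cauchy u p ->
    exists2 f, V f & seminorm_cvg u p f.

Definition seminormed_space V p : Prop :=
  linear_subspace V /\ seminorm_on V p.

Definition banach_space V p : Prop :=
  [/\ linear_subspace V, norm_on V p & seminorm_complete V p].

End SemiNormedSubspaces.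

Section OptimalDomain.
Variable R : realType.
Implicit Types (X : set (HD R)) (p : HD R -> R).

Definition continuous_inclusion X p : Prop :=
  forall f, X f -> forall U : set (HD R), nbhs f U ->
    exists2 e : R, 0 < e & forall g, X g -> p (g - f) < e -> U g.

Definition banach_space_of_analytic_functions X p : Prop :=
  banach_space X p /\ continuous_inclusion X p.

Definition Ker (T : {linear HD R -> HD R}) : set (HD R) :=
  [set f | T f = 0].

Definition optimal_domain (T : {linear HD R -> HD R}) X : set (HD R) :=
  [set f | X (T f)].

Definition optimal_seminorm (T : {linear HD R -> HD R}) p (f : HD R) : R :=
  p (T f).

End OptimalDomain.

(* Main.v *)
(* Pick [h <> 0] in [Ker T] and [g] with [T g = h].  Then [g] lies in the optimal
   domain at constant distance [normX h > 0] from every element of [Ker T], and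
   [h] itself has semi-norm 0.  Since [T] maps the optimal domain onto [Ker T],
   completeness reduces to that of [Ker T].  That [Ker T] is a Banach space of
   analytic functions holds for any finite-dimensional space: by compactness of
   the unit sphere of ['rV[R]_m], its norm controls the coordinates in a basis,
   hence every semi-norm, in particular the suprema over compact sets. *)

Require Import Defs.
From HB Require Import structures.
From mathcomp Require Import all_boot all_order all_algebra.
From mathcomp Require Import all_classical all_reals all_analysis.
From mathcomp.real_closed Require Import complex.

Set Implicit Arguments.
Unset Strict Implicit.
Unset Printing Implicit Defensive.

Import Order.TTheory GRing.Theory Num.Theory.
Import numFieldNormedType.Exports.

Local Open Scope classical_set_scope.
Local Open Scope ring_scope.

(** * Semi-norms and norms on real row vectors *)

Section RowVectorSeminorms.
Variables (R : realType) (m : nat) (s : 'rV[R]_m -> R).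
Hypothesis sD : forall x y, s (x + y) <= s x + s y.
Hypothesis sZ : forall a x, s (a *: x) = `|a| * s x.

Lemma row_seminorm_ge0 x : 0 <= s x.
Proof.
have s0 : s 0 = 0 by rewrite -(scale0r 0) sZ normr0 mul0r.
have := sD x (-1 *: x); rewrite sZ normrN1 mul1r scaleN1r subrr s0.
by rewrite -mulr2n pmulrn_lge0.
Qed.

(** Expand [x] in the standard basis; the sup norm bounds each coordinate. *)
Lemma row_seminorm_le x : s x <= (\sum_j s (delta_mx 0 j)) * `|x|.
Proof.
have sx : s x <= \sum_j s (x 0 j *: delta_mx 0 j).
  rewrite {1}(row_sum_delta x); elim/big_ind2: _ => [|a b c d ab cd|//].
  - by rewrite -(scale0r 0) sZ normr0 mul0r.
  - exact: le_trans (sD _ _) (lerD ab cd).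
apply: le_trans sx _; rewrite mulr_suml; apply: ler_sum => j _.
rewrite sZ mulrC ler_wpM2l ?row_seminorm_ge0 //.
by rewrite [leRHS]mx_normrE (le_bigmax _ (fun ij => `|x ij.1 ij.2|) (0, j)).
Qed.

(** By the reverse triangle inequality and [row_seminorm_le], [s] is Lipschitz for the sup norm. *)
Lemma row_seminorm_continuous : continuous s.
Proof.
move=> x; apply/(@cvgrPdist_lt _ _ _ (nbhs x) (nbhs_filter x)) => e e0.
pose C := \sum_j s (delta_mx 0 j).
have C0 : 0 <= C by apply: sumr_ge0 => j _; exact: row_seminorm_ge0.
have sN y : s (- y) = s y by rewrite -scaleN1r sZ normrN1 mul1r.
have dist y : `|s x - s y| <= C * `|x - y|.
  apply: le_trans (row_seminorm_le _); rewrite ler_norml lerBlDr.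
  have h := sD (x - y) y; rewrite subrK in h.
  have := sD (y - x) x; rewrite subrK -opprB sN => h'.
  by rewrite lerNl opprB lerBlDr h' h.
near=> y; apply: le_lt_trans (dist y) _.
(* [C] may vanish, so the radius is obtained by dividing by [C + 1]. *)
apply: (@le_lt_trans _ _ ((C + 1) * `|x - y|)).
  by rewrite ler_wpM2r // lerDl.
rewrite mulrC -ltr_pdivlMr; last exact: ltr_wpDl.
near: y; apply/nbhs_ballP; exists (e / (C + 1)) => //=.
  by rewrite divr_gt0 // ltr_wpDl.
by move=> y; rewrite mx_norm_ball.
Unshelve. all: by end_near. Qed.

Hypothesis s_eq0 : forall x, s x = 0 -> x = 0.

(** On the compact unit sphere [s] attains a minimum, which is positive by definiteness; homogeneity
    then gives the bound with [M] its inverse. *)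
Lemma row_norm_le : exists2 M : R, 0 < M & forall x, `|x| <= M * s x.
Proof.
pose S := [set x : 'rV[R]_m | `|x| = 1].
have normalize x : x != 0 -> S (`|x|^-1 *: x).
  move=> x0; rewrite /S /= normrZ normfV normr_id mulVf //.
  by rewrite normr_eq0.
(* If the sphere is empty, 0 is the only vector and any constant works. *)
have [[x0 Sx0]|S0] := pselect (S !=set0); last first.
  exists 1 => // x; have [->|/normalize Sx] := eqVneq x 0.
    by rewrite normr0 mul1r row_seminorm_ge0.
  by exfalso; apply: S0; eexists; exact: Sx.
have cS : compact S.
  apply: bounded_closed_compact.
    by exists 1; split => // y y1 x /= ->; exact: ltW.
  have -> : S = (fun x => `|x|) @^-1` [set 1] by [].
  apply: closed_comp; last exact: closed_eq.
  by move=> x _; exact: norm_continuous.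
have [c cS' cmin] := @compact_EVT_min _ _ s S (ex_intro _ x0 Sx0) cS
  (continuous_subspaceT row_seminorm_continuous).
have sc : 0 < s c.
  rewrite lt_neqAle row_seminorm_ge0 andbT eq_sym.
  apply/negP => /eqP/s_eq0 c0; move: cS'; rewrite inE /S /= c0 normr0.
  by move=> /esym/eqP; rewrite oner_eq0.
exists (s c)^-1; rewrite ?invr_gt0 // => x.
have [->|x0'] := eqVneq x 0.
  by rewrite normr0 mulr_ge0 ?row_seminorm_ge0 // invr_ge0 ltW.
have := cmin _ (mem_set (normalize _ x0')).
have nx : 0 < `|x| by rewrite normr_gt0.
rewrite sZ gtr0_norm ?invr_gt0 // mulrC ler_pdivlMr // => h.
by rewrite mulrC ler_pdivlMr // mulrC.
Qed.

End RowVectorSeminorms.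

(** * The complex modulus as a real number *)

Section ComplexModulus.
Variable R : realType.
Implicit Types a b : Cplx R.

Definition modulus a : R := complex.Re `|a|.

Lemma modulusE a : `|a| = (modulus a)%:C%C.
Proof. by rewrite /modulus RRe_real // normr_real. Qed.

Lemma modulus_ge0 a : 0 <= modulus a.
Proof. by rewrite -lecR -modulusE; exact: (normr_ge0 a). Qed.

Lemma modulusD a b : modulus (a + b) <= modulus a + modulus b.
Proof. by rewrite -lecR rmorphD /= -!modulusE; exact: ler_normD. Qed.

Lemma modulusM a b : modulus (a * b) = modulus a * modulus b.
Proof.
apply: (@complexI R).
by rewrite rmorphM /= -!modulusE; exact: normrM.
Qed.

Lemma modulusR (r : R) : modulus (r%:C%C : Cplx R) = `|r|.
Proof. by rewrite /modulus normc_def /= expr0n addr0 sqrtr_sqr. Qed.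

End ComplexModulus.

(** * Norms on finite-dimensional complex spaces *)

Section FiniteDimension.
Variables (R : realType) (E : lmodType (Cplx R)).
Implicit Types (V : set E) (p s : E -> R).

(** A spanning family of minimal length is free: a relation with [c i != 0] would allow [e i] to be
    dropped. *)
Lemma finite_dimensional_basis V :
  finite_dimensional V -> exists n (e : 'I_n -> E),
    [/\ forall i, V (e i),
        forall f, V f -> exists c : 'I_n -> Cplx R, f = \sum_(i < n) c i *: e i
      & forall c : 'I_n -> Cplx R, \sum_(i < n) c i *: e i = 0 ->
          forall i, c i = 0].
Proof.
pose spanned n := exists e : 'I_n -> E, (forall i, V (e i)) /\
  forall f, V f -> exists c : 'I_n -> Cplx R, f = \sum_(i < n) c i *: e i.
move=> [n0 spanned_n0].
have ex : exists n, `[< spanned n >] by exists n0; apply/asboolP.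
case: (ex_minnP ex) => n /asboolP[e [Ve eV]] nmin.
exists n, e; split => // c c0 i.
apply/eqP; apply: contraT => ci.
case: n => [|n] in e Ve eV nmin c c0 i ci *; first by case: i ci.
suff : (n.+1 <= n)%N by rewrite ltnn.
apply/nmin/asboolP; exists (e \o lift i); split => [j|f /eV[d ->]].
  exact: Ve.
(* These coefficients come from solving the relation for [e i] and substituting the result in the
   expansion with coefficients [d]. *)
exists (fun j => d (lift i j) - d i / c i * c (lift i j)).
have {}ei : e i = \sum_(j < n) - (c i)^-1 * c (lift i j) *: e (lift i j).
  move: c0; rewrite (bigD1_ord i) //= => /eqP; rewrite addr_eq0 => /eqP h.
  rewrite -[LHS]scale1r -(mulVf ci) -scalerA h scalerN -scaleNr.
  by rewrite scaler_sumr; apply: eq_bigr => j _; rewrite scalerA.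
rewrite (bigD1_ord i) //= [in X in d i *: X]ei scaler_sumr -big_split /=.
apply: eq_bigr => j _; rewrite scalerA -scalerDl; congr (_ *: _).
by rewrite addrC mulNr mulrN mulrA.
Qed.

(* Real coordinates make the compactness and completeness of ['rV[R]_m]
   available. *)
Lemma finite_dimensional_coordinates V :
    linear_subspace V -> finite_dimensional V ->
  exists m (phi : 'rV[R]_m -> E),
    [/\ forall x, V (phi x), forall f, V f -> exists x, f = phi x,
        forall x y, phi (x + y) = phi x + phi y,
        forall (a : R) x, phi (a *: x) = (a%:C%C : Cplx R) *: phi x
      & forall x, phi x = 0 -> x = 0].
Proof.
move=> [V0 VL] /finite_dimensional_basis[n [e [Ve eV free]]].
pose k (x : 'rV[R]_(n + n)) i : Cplx R :=
  (x 0 (lshift n i) +i* x 0 (rshift n i))%C.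
exists (n + n)%N, (fun x => \sum_(i < n) k x i *: e i); split.
- move=> x; elim/big_rec: _ => [|i f _ Vf]; first exact/set_mem/V0.
  by apply/set_mem/VL; rewrite inE //; exact: Ve.
- move=> f /eV[c ->].
  exists (row_mx (\row_i complex.Re (c i)) (\row_i complex.Im (c i))).
  apply: eq_bigr => i _; congr (_ *: _).
  by rewrite /k row_mxEl row_mxEr !mxE; case: (c i).
- move=> x y; rewrite -big_split; apply: eq_bigr => i _ /=.
  by rewrite -scalerDl /k !mxE.
- move=> a x; rewrite scaler_sumr; apply: eq_bigr => i _.
  rewrite scalerA /k !mxE; congr (_ *: _).
  by apply/eqP; rewrite eq_complex /= !mul0r subr0 addr0 !eqxx.
- move=> x /free kx0; apply/rowP => j; rewrite mxE.
  case: (split_ordP j) => i ->; have /eqP := kx0 i;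
    by rewrite eq_complex /= => /andP[/eqP ? /eqP ?].
Qed.

(** In real coordinates [p] is a norm on row vectors, so it dominates the sup norm. The family [b]
    is fixed before [s]: the same vectors serve all semi-norms, later the evaluations at every point
    of a compact set. *)
Lemma finite_dimensional_norm V p :
    linear_subspace V -> finite_dimensional V -> norm_on V p ->
  (exists m (b : 'I_m -> E), (forall j, V (b j)) /\
    forall s, seminorm_on V s ->
      forall f, V f -> s f <= (\sum_j s (b j)) * p f) /\
  seminorm_complete V p.
Proof.
move=> Vlin /(finite_dimensional_coordinates Vlin).
move=> [m [phi [Vphi phiV phiD phiZ phi0]]] [psemi p0].
have semiD s : seminorm_on V s ->
    forall x y, s (phi (x + y)) <= s (phi x) + s (phi y).
  by move=> [_ sD _] x y; rewrite phiD sD.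
have semiZ s : seminorm_on V s ->
    forall a x, s (phi (a *: x)) = `|a| * s (phi x).
  by move=> [_ _ sZ] a x; rewrite phiZ sZ // -/(modulus _) modulusR.
have [M M0 leM] := row_norm_le (semiD p psemi) (semiZ p psemi)
  (fun x h => phi0 x (p0 _ (Vphi x) h)).
split.
  (* The constant [M] is absorbed into the vectors. *)
  exists m, (fun j => phi (M *: delta_mx 0 j)); split => // s ss f /phiV[x ->].
  apply: le_trans (row_seminorm_le (semiD s ss) (semiZ s ss) x) _.
  under [in leRHS]eq_bigr do rewrite semiZ // gtr0_norm //.
  rewrite -mulr_sumr -mulrA mulrCA ler_wpM2l //.
  apply: sumr_ge0 => j _; by case: ss => + _ _; apply.
move=> u Vu cu.
have /choice[x ux] : forall k, exists x, u k = phi x by move=> k; exact: phiV.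
have phiB y z : phi y - phi z = phi (y - z).
  by apply/eqP; rewrite subr_eq -phiD subrK.
(* As [M * p] dominates the sup norm of the coordinates, these form a Cauchy sequence too. *)
have : cauchy (x @ \oo).
  apply/cauchy_ballP => e e0.
  have [N uN] := cu (e / M) (divr_gt0 e0 M0).
  exists (x @` [set k | (N <= k)%N], x @` [set k | (N <= k)%N]) => /=.
    by split; exists N => // k Nk; exists k.
  move=> [_ _] /= [[k Nk <-] [l Nl <-]]; rewrite mx_norm_ball /ball_ /=.
  apply: le_lt_trans (leM _) _; rewrite mulrC -ltr_pdivlMr //.
  by rewrite -phiB -!ux; exact: uN.
move=> /cauchy_cvg/cvg_ex[/= l xl].
exists (phi l) => //; rewrite /seminorm_cvg.
(* Conversely, [p \o phi] is continuous, so convergence of the coordinates gives convergence for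
   [p]. *)
have -> : (fun k => p (u k - phi l)) = (fun y => p (phi (y - l))) \o x.
  by apply/funext => k /=; rewrite ux phiB.
have pl : p (phi (l - l)) = 0.
  by rewrite subrr -(scale0r 0) semiZ // normr0 mul0r.
rewrite -[X in _ --> X]pl.
apply: (@continuous_cvg _ _ _ \oo _ x (fun y => p (phi (y - l))) l) => //.
apply: (@continuous_comp _ _ _ (fun y : 'rV[R]_m => y - l) (p \o phi) l).
  by apply: continuousB; [exact: cvg_id|exact: cst_continuous].
exact: (row_seminorm_continuous (semiD p psemi) (semiZ p psemi)).
Qed.

End FiniteDimension.

(** * Analytic functions and uniform convergence on compact sets *)

Section AnalyticFunctions.
Variable R : realType.
Implicit Types (f g : HD R) (K : set (Cplx R)).

Lemma HD_continuous f z : @unit_disc R z -> {for z, continuous f}.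
Proof.
move=> Dz; apply: differentiable_continuous; apply/derivable1_diffP.
by have /asboolP[+ _] := HDvalP f; apply.
Qed.

Lemma HD_bounded_on_compact f K :
  disc_compacts K -> exists B, forall z, K z -> modulus (f z) <= B.
Proof.
move=> [cK KD].
have [K0|K0] := pselect (K !=set0); last first.
  by exists 0 => z Kz; exfalso; apply: K0; exists z.
have [|c _ cmax] := @compact_EVT_max _ _ (fun z => modulus (f z)) K K0 cK.
  apply: continuous_in_subspaceT => z /set_mem/KD Dz.
  apply/(@cvgrPdist_lt _ _ _ (nbhs z) (nbhs_filter z)) => e e0.
  have fz : f w @[w --> z] --> f z := HD_continuous Dz.
  have e0' : 0 < e%:C%C :> Cplx R by rewrite ltcR.
  move/cvgrPdist_lt: fz => /(_ _ e0'); apply: filterS => w.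
  rewrite modulusE ltcR; apply: le_lt_trans.
  (* Reverse triangle inequality for the modulus. *)
  rewrite ler_norml lerBlDr lerNl opprB lerBlDr.
  rewrite -{3}(subrK (f w) (f z)) modulusD andbT.
  rewrite -{1}(subrK (f z) (f w)) (le_trans (modulusD _ _)) // lerD2r.
  by rewrite /modulus distrC.
by exists (modulus (f c)) => z Kz; apply: cmax; exact: mem_set.
Qed.

Lemma modulus_eval_seminorm (X : set (HD R)) z :
  seminorm_on X (fun f => modulus (f z)).
Proof.
split => [f _|f g _ _|a f _]; [exact: modulus_ge0|exact: modulusD|].
exact: modulusM.
Qed.

(** Control of the suprema over compact sets by [p] turns convergence for [p] into uniform
    convergence on compact sets. *)
Lemma locally_bounded_inclusion (X : set (HD R)) (p : HD R -> R) :
    linear_subspace X -> seminorm_on X p ->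
    (forall K, disc_compacts K -> exists2 B, 0 < B &
      forall f z, X f -> K z -> modulus (f z) <= B * p f) ->
  continuous_inclusion X p.
Proof.
move=> [X0 XL] [p0 pD pZ] evalB f Xf U Uf.
have XB g : X g -> X (g - f).
  move=> Xg; apply/set_mem; rewrite addrC -scaleN1r.
  by apply: XL; rewrite inE.
pose ball_p (e : R) := [set g | X g /\ p (g - f) < e].
(* [F] is the filter generated by the [p]-balls of [X] around [f]; the claim amounts to its
   convergence to [f]. *)
pose F : set_system (HD R) := filter_from [set e : R | 0 < e] ball_p.
have FF : Filter F.
  apply: filter_from_filter; first by exists 1 => /=.
  move=> a b a0 b0; exists (Num.min a b); first by rewrite /= lt_min a0.
  by move=> g [Xg]; rewrite lt_min => /andP[? ?].
suff /(_ U Uf) [e e0 eU] : F --> f by exists e => // g Xg ge; apply: eU.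
(* The topology of [HD R] is initial for [HD_family], so convergence is tested on each compact
   set. *)
have : HD_family g @[g --> F] --> HD_family f.
  apply/fam_cvgP => K dK W /uniform_nbhs[N [entN subW]].
  move: entN; rewrite -entourage_from_ballE => -[d /= d0 dN].
  have [B B0 leB] := evalB K dK.
  (* The radius [d] is a positive element of [Cplx R], hence real. *)
  have dR : d = (complex.Re d)%:C%C by rewrite RRe_real // gtr0_real.
  have rd0 : 0 < complex.Re d by rewrite -ltcR -dR.
  exists (complex.Re d / B) => /=; first by rewrite divr_gt0.
  move=> g [Xg gf]; apply: subW => z Kz; apply: dN.
  rewrite /= -ball_normE /ball_ /= distrC modulusE dR ltcR.
  apply: le_lt_trans (leB (g - f) z (XB _ Xg) Kz) _.
  by rewrite mulrC -ltr_pdivlMr.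
move=> Ff A [_ [[W oW <-] Wf WA]].
have /Ff : nbhs (HD_family f) W by exact: open_nbhs_nbhs.
by exact: (@filterS _ F FF _ _ WA).
Qed.

Lemma finite_dimensional_banach (X : set (HD R)) (p : HD R -> R) :
    linear_subspace X -> finite_dimensional X -> norm_on X p ->
  banach_space_of_analytic_functions X p.
Proof.
move=> Xlin Xfin Xp.
have [[m [b [Xb bX]]] cX] := finite_dimensional_norm Xlin Xfin Xp.
split; first by split.
case: (Xp) => [[p0 pD pZ] _].
apply: locally_bounded_inclusion => // K dK.
have /choice[B bB] : forall j, exists B, forall z, K z -> modulus (b j z) <= B.
  by move=> j; exact: HD_bounded_on_compact.
(* The absolute values and the added 1 make the bound positive whatever the [B j] are. *)
exists (\sum_j `|B j| + 1); first by rewrite ltr_wpDl // sumr_ge0.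
move=> f z Xf Kz.
apply: le_trans (bX _ (@modulus_eval_seminorm X z) f Xf) _.
rewrite ler_wpM2r ?p0 // ler_wpDr // ler_sum // => j _.
exact: le_trans (bB j z Kz) (ler_norm _).
Qed.

End AnalyticFunctions.

(** * The kernel of [T] and its optimal domain *)

Theorem proposition5p3 (R : realType) (T : {linear HD R -> HD R})
    (T_continuous : continuous T)
    (T_not_injective : ~ injective T)
    (ker_sub_range : Ker T `<=` range T)
    (ker_finite_dim : finite_dimensional (Ker T))
    (normX : HD R -> R)
    (normX_is_norm : norm_on (Ker T) normX) :
  let X := Ker T in
  let TX := optimal_domain T X in
  let normTX := optimal_seminorm T normX in
  [/\ banach_space_of_analytic_functions X normX
    & T @` X `<=` X] /\
  TX = T @^-1` X /\
  [/\ X `<` TX,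
      seminormed_space TX normTX /\ ~ norm_on TX normTX,
      ~ seminorm_dense X TX normTX
    & seminorm_complete TX normTX].
Proof.
move=> X TX normTX.
have X0 : X 0 by exact: linear0.
have XL a f g : X f -> X g -> X (a *: f + g).
  by rewrite /X /Ker /= linearP => -> ->; rewrite scaler0 addr0.
have XT f : X f -> X (T f) by move=> Xf; rewrite Xf.
have Xlin : linear_subspace X.
  by split => [|a f g]; rewrite !inE //; exact: XL.
have TXlin : linear_subspace TX.
  split => [|a f g]; rewrite !inE /TX /optimal_domain /= ?linear0 //.
  by rewrite linearP; exact: XL.
have [h Xh h0] : exists2 h, X h & h != 0.
  have [//|X_trivial] := pselect (exists2 h, X h & h != 0).
  exfalso; apply: T_not_injective => f g Tfg; apply/eqP.
  rewrite -subr_eq0; apply: contraT => fg0; exfalso; apply: X_trivial.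
  by exists (f - g) => //; rewrite /X /Ker /= linearB Tfg subrr.
have [g _ Tg] := ker_sub_range h Xh.
have TXg : TX g by rewrite /TX /optimal_domain /= Tg.
have [p_semi p_eq0] := normX_is_norm; have [p_ge0 pD pZ] := p_semi.
have p0 : normX 0 = 0 by rewrite -(scale0r 0) pZ // normr0 mul0r.
have X_banach := finite_dimensional_banach Xlin ker_finite_dim normX_is_norm.
split; first by split => // _ [f Xf <-]; exact: XT.
split => //; split.
- split => [f|TXX]; first exact: XT.
  (* If [g] were in the kernel, [h = T g] would vanish. *)
  by move/negP: h0; apply; rewrite -Tg; apply/eqP; exact: TXX.
- split.
    split => //; split => [f|f f'|a f] TXf; first exact: p_ge0.
      by move=> TXf'; rewrite /normTX /optimal_seminorm linearD; exact: pD.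
    by rewrite /normTX /optimal_seminorm linearZ; exact: pZ.
  move=> [_ /(_ h (XT _ Xh))]; rewrite /normTX /optimal_seminorm Xh => /(_ p0).
  by move/eqP; apply/negP.
- move=> dense.
  have nh : 0 < normX h.
    by rewrite lt_neqAle p_ge0 // andbT eq_sym; apply: contraNN h0 => /eqP/p_eq0->.
  (* Density at [g] with radius [normX h] would give [normX h < normX h], since [T (g - f) = h]. *)
  have [f Xf] := dense g TXg _ nh.
  by rewrite /normTX /optimal_seminorm linearB Tg Xf subr0 ltxx.
- move=> u TXu cu; have [[_ _ X_complete] _] := X_banach.
  (* [T] preserves the semi-norms of differences, so the images [T (u n)] converge in [X]; any
     preimage of their limit is a limit of [u]. *)
  have [||y Xy uy] := X_complete (T \o u) => //.
    move=> e /cu[N uN]; exists N => k l Nk Nl /=.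
    by rewrite -linearB; exact: uN.
  have [f _ Tf] := ker_sub_range y Xy; exists f.
    by rewrite /TX /optimal_domain /= Tf.
  apply: cvg_trans uy; apply: near_eq_cvg; apply: nearW => k /=.
  by rewrite /normTX /optimal_seminorm linearB Tf.
Qed.
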